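(* Let $V$ be a complex vector space of dimension $3$, and let $G=\mathrm{Aut}(V)$ act naturally on $W'=\Lambda^3V^*\otimes S^2V$. Then $G$ has exactly four orbits on $W'$, classified by the rank $r\in\{0,1,2,3\}$. The orbit of rank $3$ has (complex) dimension $6$ and is open and dense in $W'$. The orbits of rank $2$, $1$, $0$ have dimensions $5$, $3$, $0$, respectively. The closure of an orbit contains all orbits of lower dimension, and $W'$ is an irreducible representation of $G$.
   Context: An element $M\in\Lambda^3V^*\otimes S^2V$ is regarded as an alternating trilinear map on $V$ with values in symmetric bilinear forms on $V^*$. The action is $(\varphi.M)(a,b,c)(\alpha,\beta)=M(\varphi^{-1}a,\varphi^{-1}b,\varphi^{-1}c)(\alpha\circ\varphi,\beta\circ\varphi)$. After choosing a basis $(e_i)$ of $V$ with dual basis $(\lambda^i)$, $M$ corresponds to the symmetric $3\times3$ matrix $A=(M(e_1,e_2,e_3)(\lambda^i,\lambda^j))_{ij}$, and the action becomes $g.A=\det(g)^{-1}gAg^T$ for $g\in\mathrm{GL}_3(\mathbb{C})$. The rank of $M$ is the rank of $A$. Closures are in the usual topology. *)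

(* Defs.v *)
From HB Require Import structures.
From mathcomp Require Import all_boot all_order all_algebra.
From mathcomp Require Import complex.
From mathcomp Require Import boolp classical_sets functions cardinality reals.
From mathcomp Require Import topology normedtype derive.

Set Implicit Arguments.
Unset Strict Implicit.
Unset Printing Implicit Defensive.

Import Order.TTheory GRing.Theory Num.Theory.
Import numFieldNormedType.Exports.

Local Open Scope classical_set_scope.
Local Open Scope ring_scope.

(* The complex numbers.  The constant makes R[i] inherit the metric topology  *)
(* that MathComp-Analysis puts on every numClosedFieldType.                   *)
Definition cplx (R : realType) : numClosedFieldType := R[i].

Section Representation.
Variables (K : fieldType) (V : vectType K).

Definition dual : vectType K := 'Hom(V, K^o).

(* Trilinear maps on V with values in bilinear forms on V^*; the intermediate *)
(* constants keep the vectType structures small.                              *)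
Definition dual1 : vectType K := 'Hom(dual, K^o).
Definition bilin : vectType K := 'Hom(dual, dual1).
Definition lin1 : vectType K := 'Hom(V, bilin).
Definition lin2 : vectType K := 'Hom(V, lin1).
Definition trilin : vectType K := 'Hom(V, lin2).

Definition tri_alternating (M : trilin) : Prop :=
  forall a b : V, [/\ M a a b = 0, M a b a = 0 & M b a a = 0].

Definition tri_symmetric (M : trilin) : Prop :=
  forall (a b c : V) (al be : dual), M a b c al be = M a b c be al.

Definition inLS (M : trilin) : Prop := tri_alternating M /\ tri_symmetric M.

Lemma linfunE (U U' : vectType K) (f : U -> U') :
  linear f -> forall u, linfun f u = f u.
Proof.
move=> flin u.
pose fL := GRing.isLinear.Build K U U' *:%R f flin.
pose ff : {linear U -> U'} := HB.pack f fL.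
exact: (lfunE ff u).
Qed.

Lemma lfun_lin (U U' : vectType K) (h : 'Hom(U, U')) (k : K) (u v : U) :
  h (k *: u + v) = k *: h u + h v.
Proof. exact: linearP. Qed.

Lemma inLS_linear (k : K) (M N : trilin) :
  inLS M -> inLS N -> inLS (k *: M + N).
Proof.
move=> [aM sM] [aN sN]; split.
  move=> a b; have [M1 M2 M3] := aM a b; have [N1 N2 N3] := aN a b.
  by split; rewrite !(add_lfunE, scale_lfunE) ?M1 ?M2 ?M3 ?N1 ?N2 ?N3
    scaler0 addr0.
by move=> a b c al be; rewrite !(add_lfunE, scale_lfunE) sM sN.
Qed.

Lemma inLS0 : inLS 0.
Proof.
by split=> [a b|a b c al be]; rewrite !zero_lfunE.
Qed.

Lemma LS_subproof : exists U : {vspace trilin}, forall M, M \in U <-> inLS M.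
Proof.
pose good n := `[< exists U : {vspace trilin},
  \dim U = n /\ forall M, M \in U -> inLS M >].
have good0 : exists n, good n.
  exists 0%N; apply/asboolP; exists 0%VS; split; first exact: dimv0.
  by move=> M; rewrite memv0 => /eqP ->; exact: inLS0.
have goodb n : good n -> (n <= \dim {:trilin})%N.
  by move=> /asboolP[U [<- _]]; exact/dimvS/subvf.
case: (ex_maxnP good0 goodb) => n /asboolP[U [dU UP]] nmax.
exists U => M; split; first exact: UP.
move=> MP; suff /eqP-> : U == (U + <[M]>)%VS.
  exact: (subvP (addvSr _ _) _ (memv_line M)).
rewrite eqEdim addvSl dU; apply: nmax; apply/asboolP.
exists (U + <[M]>)%VS; split=> // N /memv_addP[u uU [v /vlineP[k ->] ->]].
by rewrite addrC; apply: inLS_linear => //; exact: UP.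
Qed.

(* The subspace $\Lambda^3V^*\otimes S^2V$ of trilin. *)
Definition LS : {vspace trilin} := projT1 (cid LS_subproof).

Lemma mem_LS (M : trilin) : M \in LS <-> inLS M.
Proof. exact: (projT2 (cid LS_subproof) M). Qed.

Definition LStype : vectType K := subvs_of LS.

Definition tri_act (g : 'End(V)) (M : trilin) : trilin :=
  linfun (fun a : V => linfun (fun b : V => linfun (fun c : V =>
    linfun (fun al : dual => linfun (fun be : dual =>
      M (g^-1%VF a) (g^-1%VF b) (g^-1%VF c) (al \o g)%VF (be \o g)%VF
        : K^o) : dual1) : bilin) : lin1) : lin2).

Lemma tri_actE (g : 'End(V)) (M : trilin) (a b c : V) (al be : dual) :
  tri_act g M a b c al be =
  M (g^-1%VF a) (g^-1%VF b) (g^-1%VF c) (al \o g)%VF (be \o g)%VF.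
Proof.
set h := g^-1%VF.
pose F5 x y z (u v : dual) : K^o := M x y z (u \o g)%VF (v \o g)%VF.
pose F4 x y z (u : dual) : dual1 := linfun (F5 x y z u).
pose F3 x y z : bilin := linfun (F4 x y z).
pose F2 x y : lin1 := linfun (fun c => F3 x y (h c)).
pose F1 x : lin2 := linfun (fun b => F2 x (h b)).
have compE (k : K) (u v : dual) :
    ((k *: u + v) \o g = k *: (u \o g) + (v \o g))%VF.
  by rewrite comp_lfunDl -comp_lfunZl.
have E5 x y z u v : F4 x y z u v = F5 x y z u v.
  by apply: linfunE => k p q; rewrite /F5 compE lfun_lin.
have E4 x y z u : F3 x y z u = F4 x y z u.
  apply: linfunE => k p q; apply/lfunP => v.
  by rewrite add_lfunE scale_lfunE !E5 /F5 compE lfun_lin add_lfunE scale_lfunE.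
have E3 x y z : F2 x y z = F3 x y (h z).
  apply: linfunE => k p q; apply/lfunP => u; apply/lfunP => v.
  do 2!rewrite add_lfunE scale_lfunE.
  rewrite !E4 !E5 /F5 !lfun_lin.
  by do 2!rewrite add_lfunE scale_lfunE.
have E2 x y : F1 x y = F2 x (h y).
  apply: linfunE => k p q; apply/lfunP => z; apply/lfunP => u; apply/lfunP => v.
  do 3!rewrite add_lfunE scale_lfunE.
  rewrite !E3 !E4 !E5 /F5 !lfun_lin.
  by do 3!rewrite add_lfunE scale_lfunE.
have E1 x : tri_act g M x = F1 (h x).
  apply: (@linfunE _ _ (fun x => F1 (h x))) => k p q; apply/lfunP => y.
  apply/lfunP => z; apply/lfunP => u; apply/lfunP => v.
  do 4!rewrite add_lfunE scale_lfunE.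
  rewrite !E2 !E3 !E4 !E5 /F5 !lfun_lin.
  by do 4!rewrite add_lfunE scale_lfunE.
by rewrite E1 E2 E3 E4 E5.
Qed.

Lemma tri_act_LS (g : 'End(V)) (M : trilin) : M \in LS -> tri_act g M \in LS.
Proof.
move=> /mem_LS[aM sM]; apply/mem_LS; split.
  move=> a b; have [M1 M2 M3] := aM (g^-1%VF a) (g^-1%VF b).
  by split; apply/lfunP => al; apply/lfunP => be;
    rewrite tri_actE ?M1 ?M2 ?M3 !zero_lfunE.
by move=> a b c al be; rewrite !tri_actE sM.
Qed.

(* vsproj only casts into the subspace here, see LS_actE. *)
Definition LS_act (g : 'End(V)) (M : LStype) : LStype :=
  vsproj LS (tri_act g (vsval M)).

Lemma LS_actE (g : 'End(V)) (M : LStype) (a b c : V) (al be : dual) :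
  vsval (LS_act g M) a b c al be =
  vsval M (g^-1%VF a) (g^-1%VF b) (g^-1%VF c) (al \o g)%VF (be \o g)%VF.
Proof. by rewrite vsprojK ?tri_actE //; exact/tri_act_LS/subvsP. Qed.

Definition LS_orbit (M : LStype) : set LStype :=
  [set N | exists g : 'End(V), bijective g /\ N = LS_act g M].

Definition LS_irreducible : Prop :=
  {:LStype}%VS != 0%VS /\
  forall U : {vspace LStype},
    (forall (g : 'End(V)) (M : LStype),
       bijective g -> M \in U -> LS_act g M \in U) ->
    U = 0%VS \/ U = {:LStype}%VS.

Definition dual_basis (e : 3.-tuple V) (i : 'I_3) : dual :=
  linfun (coord e i : V -> K^o).

Definition LS_mx (e : 3.-tuple V) (M : LStype) : 'M[K]_3 :=
  \matrix_(i, j) vsval M e`_0 e`_1 e`_2 (dual_basis e i) (dual_basis e j).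

Definition LS_rank (e : 3.-tuple V) (M : LStype) : nat := \rank (LS_mx e M).

End Representation.

Section UsualTopology.
Variables (K : numFieldType) (E : vectType K).

Definition coords (x : E) : 'rV[K]_(\dim {:E}) :=
  passmx.rVof (vbasis {:E}) x.

(* The usual topology of a finite-dimensional vector space, transported from  *)
(* K^n by linear coordinates.                                                 *)
Definition usual : topologicalType := initial_topology coords.

(* S is a (locally closed, embedded) complex submanifold of dimension d of E: *)
(* around each of its points there is a biholomorphic chart f : U -> f @` U,  *)
(* with inverse g, between open subsets of K^n that flattens S to the         *)
(* vanishing of the last n - d coordinates.  Differentiability is over K.     *)
Definition submanifold_of_dim (d : nat) (S : set E) : Prop :=
  (d <= \dim {:E})%N /\
  forall p, S p -> exists (U : set 'rV[K]_(\dim {:E}))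
                          (f g : 'rV[K]_(\dim {:E}) -> 'rV[K]_(\dim {:E})),
    [/\ open U /\ U (coords p),
        open (f @` U),
        (forall x, U x -> differentiable f x /\ g (f x) = x),
        (forall y, (f @` U) y -> differentiable g y) &
        f @` (U `&` coords @` S) =
        f @` U `&`
          [set y : 'rV[K]_(\dim {:E}) |
             forall i : 'I_(\dim {:E}), (d <= i)%N -> y 0 i = 0]].

End UsualTopology.

(* Main.v *)
(* An alternating trilinear map on a 3-dimensional space is a multiple of the
   volume form, so M is the same thing as the symmetric matrix A, and g acts by
   congruence up to the factor det(g)^-1; replacing g by t g with t = det(g)^-1
   absorbs that factor.  Hence the orbits are the congruence classes of complex
   symmetric matrices, i.e. the rank strata, with normal forms
   diag(1,..,1,0,..,0).

   By homogeneity it is enough to find a chart at each normal form.  Writing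
   A = [a b; b^T c] with a invertible of size r, the rank of A is r if and only
   if the Schur complement c - b^T a^-1 b vanishes, and the shear subtracting
   b^T a^-1 b from c flattens the stratum.  The dimension of a submanifold is
   unique because the derivative of a transition map is invertible and preserves
   the flattened subspaces.  The segment from diag(1_r,0) to diag(1_s,0) has rank
   s away from its first end, which gives the closures.  An invariant subspace
   containing a matrix of rank r > 0 contains two normal forms of rank r that
   differ by a rank one matrix, hence all rank one matrices, hence everything. *)
Require Import Defs.
From HB Require Import structures.
From mathcomp Require Import all_boot all_order all_algebra.
From mathcomp Require Import complex.
From mathcomp Require Import boolp classical_sets functions cardinality reals.
From mathcomp Require Import topology normedtype derive.
From mathcomp Require Import ring.
Import Order.TTheory GRing.Theory Num.Theory.
Import numFieldNormedType.Exports.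
Local Open Scope classical_set_scope.
Local Open Scope ring_scope.

Set Implicit Arguments.
Unset Strict Implicit.
Unset Printing Implicit Defensive.

(** * Congruence of symmetric matrices *)

Lemma congr_sym (K : comNzRingType) m n (P : 'M[K]_(m, n)) (A : 'M[K]_n) :
  A^T = A -> (P *m A *m P^T)^T = P *m A *m P^T.
Proof. by move=> sA; rewrite !trmx_mul trmxK sA mulmxA. Qed.

Lemma mxrank_congr (F : fieldType) n (P A : 'M[F]_n) :
  P \in unitmx -> \rank (P *m A *m P^T) = \rank A.
Proof.
move=> uP; rewrite mxrankMfree ?row_free_unit ?unitmx_tr //.
by rewrite (eqmxMfull A) ?row_full_unit.
Qed.

(** Polarization: if the diagonal entries at i and j vanish and A_ij does not, the form takes the
    value 2 A_ij at e_i + e_j, which is nonzero in characteristic zero. *)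
Lemma sym_anisotropic_row (F : numFieldType) n (A : 'M[F]_n) :
  A^T = A -> A != 0 -> exists v : 'rV[F]_n, (v *m A *m v^T) 0 0 != 0.
Proof.
move=> sA A0; have [i [j Aij]] : exists i j, A i j != 0.
  case: (pickP (fun ij => A ij.1 ij.2 != 0)) => [[i j] ?|A00].
    by exists i, j.
  case/eqP: A0; apply/matrixP => i j; rewrite mxE; apply/eqP.
  by move: (A00 (i, j)) => /= /negbFE.
pose q (v w : 'rV_n) : F := (v *m A *m w^T) 0 0.
have qE k l : q (delta_mx 0 k) (delta_mx 0 l) = A k l.
  by rewrite /q -rowE trmx_delta -colE !mxE.
have [Aii|Aii] := eqVneq (A i i) 0; last first.
  by exists (delta_mx 0 i); rewrite -/(q _ _) qE.
have [Ajj|Ajj] := eqVneq (A j j) 0; last first.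
  by exists (delta_mx 0 j); rewrite -/(q _ _) qE.
exists (delta_mx 0 i + delta_mx 0 j).
rewrite raddfD /= !(mulmxDl, mulmxDr) mxE [X in X + _]mxE [X in _ + X]mxE.
have Aji : A j i = A i j by rewrite -{1}sA mxE.
rewrite -!/(q _ _) !qE Aii Ajj add0r addr0 Aji -mulr2n.
by rewrite mulrn_eq0.
Qed.

(** A vector on which the quadratic form is nonzero is divided by a square root of its value, and
    the result becomes the first row of P. *)
Lemma sym_congr_unit_corner (K : numClosedFieldType) n (A : 'M[K]_(1 + n)) :
  A^T = A -> A != 0 ->
  exists2 P, P \in unitmx & (P *m A *m P^T) 0 0 = 1.
Proof.
move=> sA A0; have [v qv] := sym_anisotropic_row sA A0.
set q := (_ *m _ *m _) 0 0 in qv.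
pose w := (sqrtC q)^-1 *: v.
have w1 : (w *m A *m w^T) 0 0 = 1.
  rewrite /w linearZ /= -!scalemxAl -scalemxAr [LHS]mxE [X in _ * X]mxE.
  by rewrite -/(q) mulrA -invfM -expr2 sqrtCK mulVf.
(* Every row of [B] is w, so e_0 B = w; since e_0 B and e_0 have equal rank, an invertible P with
   the same first row exists. *)
pose B : 'M[K]_(1 + n) := \matrix_(i, j) w 0 j.
have e0B : (delta_mx 0 0 : 'rV_(1 + n)) *m B = w.
  by rewrite -rowE; apply/rowP => j; rewrite !mxE.
have : \rank ((delta_mx 0 0 : 'rV_(1 + n)) *m B) =
       \rank (delta_mx 0 0 : 'rV[K]_(1 + n)).
  rewrite e0B mxrank_delta rank_rV; case: eqP w1 => // ->.
  by rewrite !mul0mx mxE => /eqP; rewrite eq_sym oner_eq0.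
move=> /complete_unitmx[P uP eP]; exists P => //.
have r0 : row 0 P = w by rewrite rowE -eP.
by rewrite -w1 -r0 tr_row -row_mul colE mulmxA -row_mul -colE !mxE.
Qed.

(** Induction on the size: once the corner is 1, an elimination step splits it off and leaves the
    Schur complement, which is again symmetric. *)
Lemma sym_congr_pid (K : numClosedFieldType) n (A : 'M[K]_n) :
  A^T = A -> exists2 P, P \in unitmx & P *m A *m P^T = pid_mx (\rank A).
Proof.
(* Any index r will do: congruence preserves the rank, which forces r to be the rank of A. *)
move=> sA; suff [P uP [r rn PA]] : exists2 P, P \in unitmx &
    exists2 r, (r <= n)%N & P *m A *m P^T = pid_mx r.
  exists P => //; rewrite -(mxrank_congr A uP) PA rank_pid_mx //.
elim: n A sA => [|n IHn] A sA.
  exists 1%:M; rewrite ?unitmx1 //; exists 0%N => //.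
  by rewrite [LHS]thinmx0 [RHS]thinmx0.
have [->|A0] := eqVneq A 0.
  exists 1%:M; rewrite ?unitmx1 //; exists 0%N => //.
  by rewrite mulmx0 mul0mx pid_mx_0.
have [P uP P1] := sym_congr_unit_corner sA A0.
pose B : 'M[K]_(1 + n) := P *m A *m P^T.
have sB : B^T = B by exact: congr_sym.
pose b : 'rV_n := ursubmx B.
have defB : B = block_mx 1 b b^T (drsubmx B).
  rewrite -[LHS]submxK trmx_ursub sB; congr (block_mx _ _ _ _).
  by apply/matrixP => i j; rewrite !ord1 [LHS]mxE [LHS]mxE !lshift0 [LHS]P1 mxE.
(* [L] clears the first column below the corner and L^T clears the first row. *)
pose L : 'M[K]_(1 + n) := block_mx 1%:M 0 (- b^T) 1%:M.
have uL : L \in unitmx by rewrite unitmxE det_lblock !det1 mulr1 unitr1.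
pose C := drsubmx B - b^T *m b.
have LB : L *m B *m L^T = block_mx 1 0 0 C.
  rewrite {1}defB tr_block_mx !mulmx_block !raddfN /= !trmx1 trmxK trmx0.
  rewrite !(mul1mx, mulmx1, mul0mx, mulmx0, addr0, mulNmx, mulmxN, add0r, oppr0).
  by rewrite !addNr mul0mx oppr0 add0r addrC.
have sC : C^T = C by rewrite /C raddfB /= trmx_mul trmxK trmx_drsub sB.
have [Q uQ [r rn QC]] := IHn C sC.
pose Q' : 'M[K]_(1 + n) := block_mx 1%:M 0 0 Q.
have uQ' : Q' \in unitmx by rewrite unitmxE det_lblock det1 mul1r -unitmxE.
exists (Q' *m L *m P); first by rewrite !unitmx_mul uQ' uL uP.
have QLB : Q' *m block_mx 1 0 0 C *m Q'^T = block_mx 1 0 0 (pid_mx r).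
  rewrite /Q' tr_block_mx !mulmx_block trmx1 !trmx0.
  by rewrite !(mul1mx, mulmx1, mul0mx, mulmx0, addr0, add0r) QC.
exists r.+1 => //.
rewrite !trmx_mul !mulmxA -(mulmxA _ P A) -(mulmxA _ (P *m A)) -/B.
rewrite -(mulmxA Q') -(mulmxA Q') LB QLB.
apply/matrixP => i j; rewrite !mxE.
by case: split_ordP => i' ->; rewrite mxE; case: split_ordP => j' ->;
  rewrite ?mxE ?ord1.
Qed.

(** * Coordinates and the action *)

Lemma det_mx33 (K : comNzRingType) (A : 'M[K]_3) :
  \det A = A 0 0 * (A 1 1 * A 2 2 - A 1 2 * A 2 1)
         - A 0 1 * (A 1 0 * A 2 2 - A 1 2 * A 2 0)
         + A 0 2 * (A 1 0 * A 2 1 - A 1 1 * A 2 0).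
Proof.
pose f m n := A (inord m) (inord n).
have Af i j : A i j = f i j by rewrite /f !inord_val.
rewrite (expand_det_row _ ord0) !big_ord_recl big_ord0 /cofactor.
rewrite !(expand_det_row _ ord0) !big_ord_recl !big_ord0 /cofactor !det_mx11.
rewrite !mxE !Af /= /bump /=; ring.
Qed.

Lemma big_ord3 (M : nmodType) (F : 'I_3 -> M) :
  \sum_i F i = F 0 + F 1 + F 2.
Proof.
rewrite !big_ord_recl big_ord0 addr0 addrA.
by congr (_ + F _ + F _); exact/val_inj.
Qed.

Section BasisOfDimension3.
Variables (K : fieldType) (V : vectType K) (e : 3.-tuple V).
Hypothesis e_basis : basis_of {:V} e.

Lemma coord_basis_sum v : v = \sum_(i < 3) coord e i v *: e`_i.
Proof. by apply: coord_span; rewrite (span_basis e_basis) memvf. Qed.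

Lemma coord_basis (i j : 'I_3) : coord e i e`_j = (i == j)%:R.
Proof. by rewrite coord_free ?(basis_free e_basis) // eq_sym. Qed.

Lemma dual_basisE i v : dual_basis e i v = coord e i v.
Proof. by rewrite /dual_basis linfunE // => k u w; rewrite linearP. Qed.

Lemma dual_basis_sum (al : dual V) : al = \sum_(i < 3) al e`_i *: dual_basis e i.
Proof.
apply/lfunP => v; rewrite sum_lfunE [v in LHS]coord_basis_sum linear_sum.
by apply: eq_bigr => i _; rewrite linearZ scale_lfunE dual_basisE; exact: mulrC.
Qed.

Definition end_mx (g : 'End(V)) : 'M[K]_3 := \matrix_(i, j) coord e i (g e`_j).

Lemma coord_end (g : 'End(V)) i v :
  coord e i (g v) = \sum_j end_mx g i j * coord e j v.
Proof.
rewrite [v in LHS]coord_basis_sum !linear_sum; apply: eq_bigr => j _.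
by rewrite !linearZ mxE /= mulrC.
Qed.

Lemma end_mx_comp f g : end_mx (f \o g)%VF = end_mx f *m end_mx g.
Proof.
apply/matrixP => i j; rewrite !mxE comp_lfunE coord_end.
by apply: eq_bigr => k _; rewrite [end_mx g _ _]mxE.
Qed.

Lemma end_mx1 : end_mx \1%VF = 1%:M.
Proof. by apply/matrixP => i j; rewrite !mxE id_lfunE coord_basis. Qed.

Definition mx_end (P : 'M[K]_3) : 'End(V) :=
  linfun (fun v => \sum_i (\sum_j P i j * coord e j v) *: e`_i).

Lemma mx_endE P v : mx_end P v = \sum_i (\sum_j P i j * coord e j v) *: e`_i.
Proof.
rewrite /mx_end linfunE // => k u w; rewrite scaler_sumr -big_split.
apply: eq_bigr => i _ /=; rewrite scalerA -scalerDl; congr (_ *: _).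
rewrite mulr_sumr -big_split; apply: eq_bigr => j _ /=.
by rewrite linearP /= mulrDr mulrCA.
Qed.

Lemma coord_mx_end P i v : coord e i (mx_end P v) = \sum_j P i j * coord e j v.
Proof.
rewrite mx_endE linear_sum (bigD1 i) //= [X in _ + X]big1 => [|k /negPf ik].
  by rewrite linearZ /= coord_basis eqxx mulr1 addr0.
by rewrite linearZ /= coord_basis eq_sym ik mulr0.
Qed.

Lemma mx_endK : cancel mx_end end_mx.
Proof.
move=> P; apply/matrixP => i j; rewrite mxE coord_mx_end (bigD1 j) //=.
rewrite coord_basis eqxx mulr1 big1 ?addr0 // => k /negPf kj.
by rewrite coord_basis kj mulr0.
Qed.

Lemma end_mxK : cancel end_mx mx_end.
Proof.
move=> g; apply/lfunP => v; rewrite mx_endE [RHS]coord_basis_sum.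
by apply: eq_bigr => i _; rewrite coord_end.
Qed.

Lemma mx_end_bij P : P \in unitmx -> bijective (mx_end P).
Proof.
move=> uP; have fg Q S : Q *m S = 1%:M -> cancel (mx_end S) (mx_end Q).
  move=> QS v; rewrite -comp_lfunE -[(_ \o _)%VF]end_mxK end_mx_comp !mx_endK QS.
  by rewrite -end_mx1 end_mxK id_lfunE.
by exists (mx_end (invmx P)); apply: fg; rewrite ?mulVmx ?mulmxV.
Qed.

Lemma end_mx_inv (g : 'End(V)) : bijective g ->
  end_mx g^-1%VF = invmx (end_mx g) /\ end_mx g \in unitmx.
Proof.
move=> gB; have kg : lker g == 0%VS by apply/lker0P; exact: bij_inj.
have : end_mx g^-1%VF *m end_mx g = 1%:M.
  by rewrite -end_mx_comp lker0_compVf // end_mx1.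
move=> gVg; have [_ ug] := mulmx1_unit gVg; split=> //.
by rewrite -[LHS]mulmx1 -(mulmxV ug) mulmxA gVg mul1mx.
Qed.

(** The volume form with value 1 on the basis, written as an expanded determinant so that linearity
    and alternation become polynomial identities. *)
Definition vol (a b c : V) : K :=
  let x := coord e in
  x 0 a * (x 1 b * x 2 c - x 1 c * x 2 b)
  - x 0 b * (x 1 a * x 2 c - x 1 c * x 2 a)
  + x 0 c * (x 1 a * x 2 b - x 1 b * x 2 a).

Lemma vol_end (g : 'End(V)) : vol (g e`_0) (g e`_1) (g e`_2) = \det (end_mx g).
Proof. by rewrite det_mx33 !mxE. Qed.

Lemma vol_basis : vol e`_0 e`_1 e`_2 = 1.
Proof.
have := vol_end \1%VF; rewrite !id_lfunE => ->.
by rewrite end_mx1 det1.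
Qed.

(** Expansion over the basis leaves the six terms with distinct indices, whose signs assemble into
    the determinant. *)
Lemma inLS_expand (M : trilin V) a b c al be : inLS M ->
  M a b c al be = vol a b c * M e`_0 e`_1 e`_2 al be :> K.
Proof.
move=> [aM _].
pose F x y z : K := M x y z al be.
have FDl x y z w : F (x + y) z w = F x z w + F y z w.
  by rewrite /F linearD !add_lfunE.
have FDm x y z w : F z (x + y) w = F z x w + F z y w.
  by rewrite /F linearD !add_lfunE.
have FDr x y z w : F z w (x + y) = F z w x + F z w y.
  by rewrite /F linearD !add_lfunE.
have FZl k x z w : F (k *: x) z w = k * F x z w.
  by rewrite /F linearZ !scale_lfunE.
have FZm k x z w : F z (k *: x) w = k * F z x w.
  by rewrite /F linearZ !scale_lfunE.
have FZr k x z w : F z w (k *: x) = k * F z w x.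
  by rewrite /F linearZ !scale_lfunE.
have F12 x z : F x x z = 0 by rewrite /F;
    have [-> _ _] := aM x z; rewrite !zero_lfunE.
have F13 x z : F x z x = 0 by rewrite /F;
    have [_ -> _] := aM x z; rewrite !zero_lfunE.
have F23 x z : F z x x = 0 by rewrite /F;
    have [_ _ ->] := aM x z; rewrite !zero_lfunE.
(* Antisymmetry, from expanding F(x + y, x + y, z) = 0. *)
have S12 x y z : F y x z = - F x y z.
  have /eqP := F12 (x + y) z.
  by rewrite FDl !FDm !F12 add0r addr0 addrC addr_eq0 => /eqP.
have S23 x y z : F z y x = - F z x y.
  have /eqP := F23 (x + y) z.
  by rewrite FDm !FDr !F23 add0r addr0 addrC addr_eq0 => /eqP.
rewrite -/(F a b c) -/(F e`_0 e`_1 e`_2).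
rewrite {1}[a]coord_basis_sum {1}[b]coord_basis_sum {1}[c]coord_basis_sum !big_ord3.
rewrite !(FDl, FZl) !(FDm, FZm) !(FDr, FZr) !(F12, F13, F23).
rewrite (S12 e`_1 e`_2 e`_0) (S23 e`_0 e`_2 e`_1) (S12 e`_0 e`_2 e`_1).
rewrite (S23 e`_1 e`_2 e`_0) (S12 e`_0 e`_1 e`_2).
rewrite /vol; ring.
Qed.

Definition mx_form (A : 'M[K]_3) (al be : dual V) : K :=
  \sum_i \sum_j A i j * al e`_i * be e`_j.

Lemma mx_formC A al be : mx_form A al be = mx_form A^T be al.
Proof.
rewrite /mx_form exchange_big; apply: eq_bigr => i _; apply: eq_bigr => j _.
by rewrite mxE mulrAC.
Qed.

Lemma mx_formPl A k al al' be :
  mx_form A (k *: al + al') be = k * mx_form A al be + mx_form A al' be.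
Proof.
rewrite /mx_form mulr_sumr -big_split; apply: eq_bigr => i _ /=.
rewrite mulr_sumr -big_split; apply: eq_bigr => j _ /=.
by rewrite add_lfunE scale_lfunE mulrDr mulrDl !mulrA (mulrC k).
Qed.

Lemma mx_formPr A k al be be' :
  mx_form A al (k *: be + be') = k * mx_form A al be + mx_form A al be'.
Proof. by rewrite mx_formC mx_formPl -!mx_formC. Qed.

Lemma inLS_formula (M : LStype V) a b c al be :
  vsval M a b c al be =
  vol a b c * mx_form (LS_mx e M) al be :> K.
Proof.
rewrite inLS_expand; last exact/mem_LS/subvsP.
congr (_ * _); rewrite {1}[al]dual_basis_sum linear_sum sum_lfunE.
apply: eq_bigr => i _; rewrite linearZ scale_lfunE.
rewrite {1}[be]dual_basis_sum linear_sum scaler_sumr.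
apply: eq_bigr => j _; rewrite linearZ mxE -!mulrA [RHS]mulrC -mulrA.
by congr (_ * _).
Qed.

Lemma LS_mx_sym (M : LStype V) : (LS_mx e M)^T = LS_mx e M.
Proof.
have /mem_LS[_ sM] := subvsP M.
by apply/matrixP => i j; rewrite !mxE sM.
Qed.

Lemma LS_mx_inj : injective (@LS_mx K V e).
Proof.
move=> M N MN; apply/val_inj/lfunP => a; apply/lfunP => b; apply/lfunP => c.
apply/lfunP => al; apply/lfunP => be; rewrite /=.
by rewrite [LHS]inLS_formula [RHS]inLS_formula MN.
Qed.

Lemma LS_mx_is_linear : linear (@LS_mx K V e).
Proof.
move=> k M N; apply/matrixP => i j; rewrite !mxE.
have -> : vsval (k *: M + N) = k *: vsval M + vsval N by exact: linearP.
by rewrite !(add_lfunE, scale_lfunE).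
Qed.

(** The inverse of g on vectors scales the volume form by det(g)^-1, while precomposing covectors
    with g turns A into g A g^T. *)
Lemma LS_mx_act (g : 'End(V)) M : bijective g ->
  LS_mx e (LS_act g M) =
    (\det (end_mx g))^-1 *: (end_mx g *m LS_mx e M *m (end_mx g)^T).
Proof.
move=> gB; have [gV ug] := end_mx_inv gB.
apply/matrixP => i j; rewrite mxE LS_actE inLS_formula vol_end gV det_inv mxE.
congr (_ * _); rewrite -mulmxA mxE; apply: eq_bigr => k _.
rewrite [X in _ = _ * X]mxE mulr_sumr; apply: eq_bigr => l _.
rewrite !comp_lfunE !dual_basisE ![end_mx _ _ _]mxE [_^T _ _]mxE.
rewrite ![end_mx _ _ _]mxE; ring.
Qed.

Definition tri_of_mx (A : 'M[K]_3) : trilin V :=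
  linfun (fun a => linfun (fun b => linfun (fun c =>
    linfun (fun al : dual V => linfun (fun be : dual V =>
      vol a b c * mx_form A al be : K^o) : dual1 V)
      : bilin V) : lin1 V) : lin2 V).

Lemma tri_of_mxE A a b c al be :
  tri_of_mx A a b c al be = vol a b c * mx_form A al be.
Proof.
(* [linfun] returns the given function only when that function is linear. Linearity is checked from
   the innermost argument outwards, since each outer check evaluates the inner maps. *)
pose F5 x y z (u v : dual V) : K^o := vol x y z * mx_form A u v.
pose F4 x y z (u : dual V) : dual1 V := linfun (F5 x y z u).
pose F3 x y z : bilin V := linfun (F4 x y z).
pose F2 x y : lin1 V := linfun (F3 x y).
pose F1 x : lin2 V := linfun (F2 x).
have scaleE (k x : K) : k *: (x : K^o) = k * x :> K by [].
have E5 x y z u v : F4 x y z u v = F5 x y z u v.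
  by apply: linfunE => k p q; rewrite /F5 mx_formPr scaleE; ring.
have E4 x y z u : F3 x y z u = F4 x y z u.
  apply: linfunE => k p q; apply/lfunP => v.
  by rewrite add_lfunE scale_lfunE !E5 /F5 mx_formPl scaleE; ring.
have E3 x y z : F2 x y z = F3 x y z.
  apply: linfunE => k p q; apply/lfunP => u; apply/lfunP => v.
  do 2!rewrite add_lfunE scale_lfunE.
  by rewrite !E4 !E5 /F5 /vol !linearP scaleE /=; ring.
have E2 x y : F1 x y = F2 x y.
  apply: linfunE => k p q; apply/lfunP => z; apply/lfunP => u; apply/lfunP => v.
  do 3!rewrite add_lfunE scale_lfunE.
  by rewrite !E3 !E4 !E5 /F5 /vol !linearP scaleE /=; ring.
have E1 x : tri_of_mx A x = F1 x.
  apply: (linfunE (f := F1)) => k p q; apply/lfunP => y.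
  apply/lfunP => z; apply/lfunP => u; apply/lfunP => v.
  do 4!rewrite add_lfunE scale_lfunE.
  by rewrite !E2 !E3 !E4 !E5 /F5 /vol !linearP scaleE /=; ring.
by rewrite E1 E2 E3 E4 E5.
Qed.

Lemma tri_of_mx_LS A : A^T = A -> tri_of_mx A \in LS V.
Proof.
move=> sA; apply/mem_LS; split=> [a b|a b c al be].
  by split; apply/lfunP => al; apply/lfunP => be;
    rewrite tri_of_mxE !zero_lfunE /vol; ring.
by rewrite !tri_of_mxE mx_formC sA.
Qed.

(** For symmetric A the trilinear map already lies in the subspace, so there the projection is only
    a change of type. *)
Definition LS_of_mx (A : 'M[K]_3) : LStype V := vsproj (LS V) (tri_of_mx A).

Lemma LS_of_mxK A : A^T = A -> LS_mx e (LS_of_mx A) = A.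
Proof.
move=> sA; apply/matrixP => i j; rewrite mxE vsprojK ?tri_of_mx_LS //.
rewrite tri_of_mxE vol_basis mul1r /mx_form (bigD1 i) //= (bigD1 j) //=.
rewrite !dual_basisE !coord_basis !eqxx !mulr1 !big1 ?addr0 //.
  move=> k /negPf ki; rewrite big1 // => l _.
  by rewrite dual_basisE coord_basis eq_sym ki mulr0 mul0r.
by move=> l /negPf lj; rewrite !dual_basisE !coord_basis eq_sym lj mulr0.
Qed.
End BasisOfDimension3.

(** * Orbits and irreducibility *)

(** The normal form depends only on the rank, so A and B are congruent to the same matrix. *)
Lemma sym_eq_rank_congr (K : numClosedFieldType) n (A B : 'M[K]_n) :
  A^T = A -> B^T = B -> \rank A = \rank B ->
  exists2 P, P \in unitmx & P *m A *m P^T = B.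
Proof.
move=> /sym_congr_pid[P uP PA] /sym_congr_pid[Q uQ QB] rAB.
exists (invmx Q *m P); first by rewrite unitmx_mul unitmx_inv uQ.
rewrite trmx_mul mulmxA -(mulmxA (invmx Q)) -(mulmxA (invmx Q)) PA rAB -QB.
rewrite trmx_inv -!mulmxA mulmxV ?unitmx_tr // mulmx1 mulmxA.
by rewrite mulVmx // mul1mx.
Qed.

(** In size three det(tP) = t^3 det(P) = t^2, which cancels the factor t^2 of the congruence by
    tP. *)
Lemma det_inv_scaled_congr (K : fieldType) (P A : 'M[K]_3) (t := (\det P)^-1) :
  P \in unitmx ->
  (\det (t *: P))^-1 *: (t *: P *m A *m (t *: P)^T) = P *m A *m P^T.
Proof.
rewrite unitmxE unitfE => dP; rewrite detZ linearZ /= -!scalemxAl -scalemxAr.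
rewrite !scalerA [X in X *: _](_ : _ = 1) ?scale1r // /t.
by field; rewrite dP oner_eq0.
Qed.

Lemma pid_mx_sum_delta (K : nzRingType) n r :
  pid_mx r = \sum_(i < n | (i < r)%N) delta_mx i i :> 'M[K]_n.
Proof.
apply/matrixP => i j; rewrite summxE mxE val_eqE.
have [<-|ij] /= := eqVneq i j.
  have [ir|ir] := boolP (i < r)%N.
    rewrite (bigD1 i) //= mxE !eqxx big1 ?addr0 // => k /andP[_ /negPf ki].
    by rewrite mxE eq_sym ki.
  by rewrite big1 // => k kr; rewrite mxE; case: eqVneq kr ir => // -> ->.
rewrite big1 // => k _; rewrite mxE; case: (eqVneq i k) => // <-.
by rewrite eq_sym (negPf ij).
Qed.

Section Orbits.
Variables (K : numClosedFieldType) (V : vectType K) (e : 3.-tuple V).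
Hypothesis e_basis : basis_of {:V} e.
Implicit Types M N : LStype V.

Lemma LS_rank_le3 M : (LS_rank e M <= 3)%N.
Proof. exact: rank_leq_row. Qed.

Lemma LS_rank_of_mx A : A^T = A -> LS_rank e (LS_of_mx e A) = \rank A.
Proof. by move=> sA; rewrite /LS_rank LS_of_mxK. Qed.

Lemma LS_of_mx_surj M : exists2 A, A^T = A & M = LS_of_mx e A.
Proof.
exists (LS_mx e M); first exact: LS_mx_sym.
by apply: (LS_mx_inj e_basis); rewrite LS_of_mxK ?LS_mx_sym.
Qed.

Lemma LS_rank_act (g : 'End(V)) M : bijective g ->
  LS_rank e (LS_act g M) = LS_rank e M.
Proof.
move=> gB; have [_ ug] := end_mx_inv e_basis gB.
rewrite /LS_rank LS_mx_act // mxrank_scale_nz ?mxrank_congr //.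
by rewrite invr_eq0 -unitfE -unitmxE.
Qed.

Lemma LS_act_congr (P : 'M[K]_3) : P \in unitmx ->
  exists2 g : 'End(V), bijective g &
    forall B, B^T = B -> LS_act g (LS_of_mx e B) = LS_of_mx e (P *m B *m P^T).
Proof.
move=> uP; exists (mx_end e ((\det P)^-1 *: P)).
  apply: mx_end_bij => //; rewrite unitmxZ // unitrV -unitmxE //.
move=> B sB; apply: (LS_mx_inj e_basis).
rewrite LS_mx_act ?mx_endK ?LS_of_mxK ?congr_sym ?det_inv_scaled_congr //.
by apply: mx_end_bij => //; rewrite unitmxZ // unitrV -unitmxE.
Qed.

Lemma LS_orbitP M N : LS_orbit M N <-> LS_rank e N = LS_rank e M.
Proof.
split=> [[g [gB ->]]|]; first exact: LS_rank_act.
have [A sA ->] := LS_of_mx_surj M; have [B sB ->] := LS_of_mx_surj N.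
rewrite !LS_rank_of_mx // => /esym/(sym_eq_rank_congr sA sB)[P uP PA].
have [g gB gE] := LS_act_congr uP.
by exists g; split; rewrite // gE // PA.
Qed.

(** P = diag(2, 1, 1) multiplies the corner entry 1 by 4. This gives two matrices of rank r whose
    difference has rank one. *)
Lemma pid_mx_congr_diag r : (0 < r)%N ->
  let P : 'M[K]_3 := 1%:M + delta_mx 0 0 in
  P \in unitmx /\ P *m pid_mx r *m P^T = pid_mx r + 3%:R *: delta_mx 0 0.
Proof.
move=> r0 P; split.
  rewrite unitmxE unitfE det_mx33 !mxE /= !(mulr0, mul0r, addr0, subr0, mulr1).
  by rewrite -mulr2n pnatr_eq0.
have dE : (delta_mx 0 0 : 'M[K]_3) *m (pid_mx r : 'M[K]_3) = delta_mx 0 0.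
  apply/matrixP => i j; rewrite mxE (bigD1 0) //= big1 ?addr0 => [|k /negPf k0].
    rewrite !mxE; case: j => [[|j] ?]; case: i => [[|i] ?];
      by rewrite //= ?mulr1 ?mulr0 // ?mul0r // r0 mulr1.
  by rewrite !mxE k0 andbF mul0r.
have Ed : (pid_mx r : 'M[K]_3) *m (delta_mx 0 0 : 'M[K]_3) = delta_mx 0 0.
  by have := congr1 trmx dE; rewrite trmx_mul trmx_delta tr_pid_mx.
rewrite /P raddfD /= trmx1 trmx_delta mulmxDl mul1mx dE mulmxDr mulmx1 mulmxDl Ed.
by rewrite mul_delta_mx -addrA !scaler_nat !mulrS addr0 addrA.
Qed.

Lemma LS_mxD k M N : LS_mx e (k *: M + N) = k *: LS_mx e M + LS_mx e N.
Proof. exact: LS_mx_is_linear. Qed.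

Lemma LS_mx0 : LS_mx e 0 = 0.
Proof. by have := LS_mxD (-1) 0 0; rewrite scaler0 addr0 scaleN1r addNr. Qed.

Lemma LS_irreducible_dim3 : LS_irreducible V.
Proof.
split.
  have M1 : LS_of_mx e 1%:M \in {:LStype V}%VS by exact: memvf.
  apply: contraTneq M1 => ->; rewrite memv0; apply/eqP => M0.
  have := LS_rank_of_mx (trmx1 K 3); rewrite M0 mxrank1.
  have -> : LS_rank e 0 = 0%N.
    by rewrite /LS_rank LS_mx0 mxrank0.
  by [].
move=> U Uact; have [->|] := eqVneq U 0%VS; first by left.
move=> U0; right; apply/eqP; rewrite eqEsubv subvf /=; apply/subvP => N _.
have Uorb M N' : M \in U -> LS_rank e N' = LS_rank e M -> N' \in U.
  by move=> MU /LS_orbitP[g [gB ->]]; exact: Uact.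
pose M := vpick U; have MU : M \in U by exact: memv_pick.
have M0 : M != 0 by rewrite vpick0.
have linI k M1 M2 : M1 \in U -> M2 \in U -> k *: M1 + M2 \in U.
  by move=> ? ?; rewrite rpredD ?rpredZ.
have r0 : (0 < LS_rank e M)%N.
  rewrite lt0n /LS_rank mxrank_eq0; apply: contraNneq M0 => LM.
  by apply/eqP/(LS_mx_inj e_basis); rewrite LS_mx0.
set r := LS_rank e M in r0.
have r3 : (r <= 3)%N := LS_rank_le3 M.
have spid : (pid_mx r)^T = pid_mx r :> 'M[K]_3 by rewrite tr_pid_mx.
have [uP PE] := pid_mx_congr_diag r0.
set P : 'M_3 := 1%:M + _ in uP PE.
(* Both matrices have rank r, so they lie in the orbit of M and hence in U; so does their difference
   3 E_00. *)
have U1 : LS_of_mx e (3%:R *: delta_mx 0 0) \in U.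
  have -> : LS_of_mx e (3%:R *: delta_mx 0 0) =
      -1 *: LS_of_mx e (pid_mx r) + LS_of_mx e (P *m pid_mx r *m P^T).
    apply: (LS_mx_inj e_basis); rewrite LS_mxD !LS_of_mxK ?congr_sym //.
      by rewrite PE scaleN1r addrA addNr add0r.
    by rewrite linearZ /= trmx_delta.
  apply: linI; apply: (Uorb M) => //; rewrite LS_rank_of_mx ?congr_sym //.
    by rewrite rank_pid_mx.
  by rewrite mxrank_congr // rank_pid_mx.
have Urank1 A : A^T = A -> \rank A = 1%N -> LS_of_mx e A \in U.
  move=> sA rA; apply: Uorb U1 _; rewrite !LS_rank_of_mx //.
    by rewrite rA mxrank_scale_nz ?pnatr_eq0 // mxrank_delta.
  by rewrite linearZ /= trmx_delta.
have [B sB ->] := LS_of_mx_surj N.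
have [Q uQ QB] := sym_congr_pid sB.
pose S := invmx Q; have uS : S \in unitmx by rewrite unitmx_inv.
(* Undoing the congruence to normal form splits B into symmetric matrices of rank one. *)
have BE : B = \sum_(i < 3 | (i < \rank B)%N) S *m delta_mx i i *m S^T.
  rewrite -mulmx_suml -mulmx_sumr.
  rewrite -pid_mx_sum_delta.
  rewrite -QB /S trmx_inv -!mulmxA mulmxV ?unitmx_tr // mulmx1.
  by rewrite mulKmx.
have -> : LS_of_mx e B =
    \sum_(i < 3 | (i < \rank B)%N) LS_of_mx e (S *m delta_mx i i *m S^T).
  apply: (LS_mx_inj e_basis); rewrite LS_of_mxK // {1}BE.
  apply: (big_ind2 (fun A M => A = LS_mx e M)).
  - by rewrite LS_mx0.
  - by move=> A1 M1 A2 M2 -> ->; rewrite -[M1]scale1r LS_mxD !scale1r.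
  - by move=> i _; rewrite LS_of_mxK ?congr_sym ?trmx_delta.
apply: memv_suml => i _; apply: Urank1; rewrite ?congr_sym ?trmx_delta //.
by rewrite mxrank_congr // mxrank_delta.
Qed.
End Orbits.

(** * Charts of submanifolds *)

Lemma open_neq0 (K : numFieldType) : open [set y : K | y != 0].
Proof.
have -> : [set y : K | y != 0] = ~` [set 0].
  by apply/seteqP; split=> y /eqP.
by apply/closed_openC/accessible_closed_set1/hausdorff_accessible/norm_hausdorff.
Qed.

Section Differentiability.
Context {K : numFieldType} {V : normedModType K}.

Lemma differentiable_row n (F : V -> 'rV[K]_n) x :
  (forall i, differentiable (fun y => F y 0 i) x) -> differentiable F x.
Proof.
move=> dF; have -> : F = \sum_(i < n) (fun y => F y 0 i *: delta_mx 0 i).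
  by apply/funext => y; rewrite fct_sumE [LHS]row_sum_delta.
by apply: differentiable_sum => i; exact: differentiableZl.
Qed.

Lemma differentiable_mulmx n m (P : 'M[K]_(n, m)) (F : V -> 'rV[K]_n) x :
  differentiable F x -> differentiable (fun y => F y *m P) x.
Proof.
move=> dF; apply: differentiable_row => i.
have -> : (fun y => (F y *m P) 0 i) = \sum_(j < n) (fun y => P j i *: (F y 0 j)).
  apply/funext => y; rewrite fct_sumE mxE; apply: eq_bigr => j _.
  by rewrite mulrC.
apply: differentiable_sum => j; apply: differentiableZ.
exact: (@differentiable_comp _ _ _ _ F (fun N : 'rV[K]_n => N 0 j) x dF
  (differentiable_coord _ _ _)).
Qed.

End Differentiability.

(** The local condition of [submanifold_of_dim], stated for subsets of K^n so that charts can be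
    carried between coordinate systems. *)
Definition chart_at (K : numFieldType) n d (S : set 'rV[K]_n) (p : 'rV[K]_n) :=
  exists (U : set 'rV[K]_n) (f g : 'rV[K]_n -> 'rV[K]_n),
    [/\ open U /\ U p, open (f @` U),
        (forall x, U x -> differentiable f x /\ g (f x) = x),
        (forall y, (f @` U) y -> differentiable g y) &
        f @` (U `&` S) = f @` U `&`
          [set y : 'rV[K]_n | forall i : 'I_n, (d <= i)%N -> y 0 i = 0]].

Lemma submanifold_of_dimE (K : numFieldType) (E : vectType K) d (S : set E) :
  submanifold_of_dim d S <-> (d <= \dim {:E})%N /\
    forall p, S p -> chart_at d (@coords K E @` S) (coords p).
Proof. by []. Qed.

Section Charts.
Context {K : numFieldType} {n : nat}.
Implicit Types (S : set 'rV[K]_n) (p x : 'rV[K]_n).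

Lemma mulmx_continuous (P : 'M[K]_n) : continuous (fun x : 'rV[K]_n => x *m P).
Proof.
by move=> x; apply: differentiable_continuous; apply: differentiable_mulmx.
Qed.

(** The chart is precomposed with P^-1 and its inverse is followed by P; the flattened image does
    not change. *)
Lemma chart_at_mulmx d S T p (P : 'M[K]_n) : P \in unitmx ->
  (forall x, S x <-> T (x *m P)) -> chart_at d S p -> chart_at d T (p *m P).
Proof.
move=> uP ST [U [f [g [[oU Up] ofU fU gU fS]]]].
pose h x := f (x *m invmx P).
have imE (A : set 'rV[K]_n) : h @` [set x | A (x *m invmx P)] = f @` A.
  apply/seteqP; split=> [_ [x /= Ax <-]|_ [x Ax <-]]; first by exists (x *m invmx P).
  by exists (x *m P); rewrite /h /= mulmxK.
exists [set x | U (x *m invmx P)], h, (fun y => g y *m P); split.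
- split; last by rewrite /= mulmxK.
  by apply: open_comp => // x _; exact: mulmx_continuous.
- by rewrite imE.
- move=> x /= Ux; have [dfx gfx] := fU _ Ux; split; last by rewrite /h gfx mulmxKV.
  apply: (@differentiable_comp _ _ _ _ (fun x => x *m invmx P) f) => //.
  exact: differentiable_mulmx.
- by rewrite imE => y fy; apply: differentiable_mulmx; exact: gU.
- rewrite imE -fS -imE; congr (h @` _); apply/seteqP; split=> x /= [Ux].
    by move=> Tx; split=> //; apply/ST; rewrite mulmxKV.
  by move=> /ST; rewrite mulmxKV.
Qed.

(* If H only depends on coordinates that it does not change, x |-> x - H x is a
   shear with inverse y |-> y + H y. *)
Lemma chart_at_shear d S p (q : 'rV[K]_n -> K) (H : 'rV[K]_n -> 'rV[K]_n) :
  continuous q -> q p != 0 ->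
  (forall x, q x != 0 -> differentiable H x) ->
  (forall x, [/\ q (x - H x) = q x, H (x - H x) = H x,
                 q (x + H x) = q x & H (x + H x) = H x]) ->
  (forall x, q x != 0 ->
     (S x <-> forall i : 'I_n, (d <= i)%N -> (x - H x) 0 i = 0)) ->
  chart_at d S p.
Proof.
move=> cq qp dH HE SE; pose U := [set x | q x != 0].
pose f x := x - H x; pose g x := x + H x.
(* The shear and its inverse both preserve q, so U is mapped onto itself. *)
have fU : f @` U = U.
  apply/seteqP; split=> [_ [x Ux <-]|x Ux].
    by rewrite /U /f /=; have [-> _ _ _] := HE x.
  have [_ _ qE HxE] := HE x; exists (g x); first by rewrite /U /g /= qE.
  by rewrite /f /g HxE addrK.
have oU : open U.
  apply: (@open_comp _ _ q [set y | y != 0]) => [x _|]; first exact: cq.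
  exact: open_neq0.
have did x : differentiable (id : 'rV[K]_n -> _) x by exact: ex_diff.
exists U, f, g; rewrite fU; split=> //.
- move=> x Ux; split; last by have [_ HxE _ _] := HE x; rewrite /f /g HxE subrK.
  by apply: differentiableB => //; exact: dH.
- by move=> x Ux; apply: differentiableD => //; exact: dH.
- apply/seteqP; split=> [_ [x [Ux /(SE x Ux) Sx] <-]|y [Uy y0]].
    by split=> //; rewrite -fU; exists x.
  move: Uy; rewrite -{1}fU => -[x Ux xy]; exists x => //; split=> //.
  by apply/(SE x Ux) => i di; rewrite -[RHS](y0 i di) -xy.
Qed.

End Charts.

(** * Uniqueness of the dimension of a submanifold *)

Section DimensionOfCharts.
Context {K : numFieldType}.

(** Acting on row vectors, A maps the span of the first d basis vectors injectively into the span of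
    the first d'. *)
Lemma mx_flag_dim (n d d' : nat) (A : 'M[K]_n) : A \in unitmx -> (d <= n)%N ->
  (forall i j : 'I_n, (i < d)%N -> (d' <= j)%N -> A i j = 0) -> (d <= d')%N.
Proof.
move=> uA dn A0.
have -> : d = \rank ((pid_mx d : 'M_n) *m A).
  by rewrite mxrankMfree ?row_free_unit // rank_pid_mx.
have [d'n|/ltnW nd'] := leqP d' n; last exact: leq_trans (rank_leq_row _) nd'.
rewrite -(rank_pid_mx K d'n d'n).
suff -> : (pid_mx d : 'M_n) *m A = (pid_mx d : 'M_n) *m A *m (pid_mx d' : 'M_n).
  exact: mxrankM_maxr.
have pidE (B : 'M[K]_n) k i j :
    ((pid_mx k : 'M_n) *m B) i j = if (i < k)%N then B i j else 0.
  rewrite mxE (bigD1 i) //= mxE eqxx /= big1 => [|l /negPf li].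
    by case: ifP; rewrite ?mul1r ?mul0r addr0.
  by rewrite mxE val_eqE eq_sym li mul0r.
apply/matrixP => i j; rewrite -mulmxA pidE [RHS]pidE; case: ifP => // id.
rewrite mxE (bigD1 j) //= mxE eqxx /= big1 => [|l /negPf li]; last first.
  by rewrite mxE val_eqE li mulr0.
by case: ltnP => jd; rewrite ?mulr1 ?mulr0 ?addr0 // A0.
Qed.

(** The difference quotients in direction v converge to the derivative, and their i-th coordinates
    vanish for small t. *)
Lemma deriv_zero_along_line n m (F : 'rV[K]_n -> 'rV[K]_m)
    (y v : 'rV[K]_n) (i : 'I_m) :
  differentiable F y -> (\forall t \near (0 : K), F (y + t *: v) 0 i = 0) ->
  'd F y v 0 i = 0.
Proof.
move=> dF F0; have F0y : F y 0 i = 0.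
  by have := nbhs_singleton F0; rewrite scale0r addr0.
rewrite -deriveE //.
pose Q (t : K) := t^-1 *: (F (t *: v + y) - F y).
have cQ : Q t @[t --> (0 : K)^'] --> 'D_v F y by exact: diff_derivable.
have cQi : Q t 0 i @[t --> (0 : K)^'] --> 'D_v F y 0 i.
  apply: (@cvg_comp _ _ _ Q (fun M : 'rV[K]_m => M 0 i) _ _ _ cQ).
  exact: coord_continuous.
apply: (@cvg_unique _ (@norm_hausdorff _ K^o) (Q t 0 i @[t --> (0 : K)^'])) => //.
apply: cvg_near_cst; apply: nbhs_dnbhs; near=> t.
rewrite /Q mxE mxE [X in _ * (_ + X)]mxE F0y subr0 addrC.
by rewrite (near F0 t) ?mulr0.
Unshelve. all: by end_near. Qed.

(** The transition map has an invertible derivative that sends the first d coordinate directions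
    into the span of the first d'. *)
Lemma chart_at_dim_le n d d' (S : set 'rV[K]_n) p : (d <= n)%N ->
  S p -> chart_at d S p -> chart_at d' S p -> (d <= d')%N.
Proof.
move=> dn Sp [U [f [g [[oU Up] ofU fU gU fS]]]].
move=> [U' [f' [g' [[oU' U'p] ofU' fU' gU' fS']]]].
pose y0 := f p.
have y0U : (f @` U) y0 by exists p.
have gy0 : g y0 = p by have [] := fU _ Up.
have dg : differentiable g y0 := gU _ y0U.
have df' : differentiable f' (g y0) by rewrite gy0; have [] := fU' _ U'p.
have df : differentiable f (g' (f' p)).
  by have [_ ->] := fU' _ U'p; have [] := fU _ Up.
have dg' : differentiable g' (f' (g y0)) by rewrite gy0; apply: gU'; exists p.
pose phi := f' \o g; pose psi := f \o g'.
have dphi : differentiable phi y0 by exact: differentiable_comp.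
have dpsi : differentiable psi (phi y0).
  by apply: differentiable_comp => //; rewrite /phi /= gy0.
have near_y0 : \forall y \near y0, (f @` U) y /\ U' (g y).
  apply: filterI; first exact: open_nbhs_nbhs.
  by apply: (differentiable_continuous dg); rewrite gy0; exact: open_nbhs_nbhs.
(* The inverse relation holds only where both charts are defined; near y0 is enough for
   derivatives. *)
have psiphi : \forall y \near y0, (psi \o phi) y = y.
  near=> y; have [[x Ux <-] U'y] : (f @` U) y /\ U' (g y) by near: y.
  have [_ gfx] := fU _ Ux; rewrite /psi /phi /= gfx.
  by rewrite gfx in U'y; have [_ ->] := fU' _ U'y.
have dd v : 'd psi (phi y0) ('d phi y0 v) = v.
  have -> : 'd psi (phi y0) ('d phi y0 v) = 'd (psi \o phi) y0 v.
    exact/esym/(congr1 (fun h => h v) (diff_comp dphi dpsi)).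
  rewrite -deriveE; last exact: differentiable_comp.
  by rewrite (near_eq_derive (g := id)) // derive_id.
pose A := lin1_mx ('d phi y0).
have uA : A \in unitmx.
  suff AB1 : A *m lin1_mx ('d psi (phi y0)) = 1%:M by exact: (mulmx1_unit AB1).1.
  by apply/row_matrixP => i; rewrite row_mul rowE !mul_rV_lin1 /= dd row1.
apply: (mx_flag_dim uA dn) => i j id' jd'.
have -> : A i j = 'd phi y0 (delta_mx 0 i) 0 j.
  rewrite -[RHS](congr1 (fun M : 'rV_n => M 0 j) (mul_rV_lin1 _ _)).
  by rewrite -rowE [RHS]mxE.
apply: deriv_zero_along_line => //.
have lc : y0 + t *: (delta_mx 0 i : 'rV[K]_n) @[t --> (0 : K)] --> y0.
  rewrite -[X in _ --> X]addr0 -(scale0r (delta_mx 0 i)).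
  exact: (cvgD (cvg_cst y0)
    (@scalel_continuous _ _ (delta_mx 0 i : 'rV[K]_n) 0)).
have : \forall t \near (0 : K),
    (f @` U) (y0 + t *: delta_mx 0 i) /\ U' (g (y0 + t *: delta_mx 0 i)).
  exact: (lc _ near_y0).
apply: filterS => t [fUt U'gt].
(* For i < d, moving from y0 along e_i keeps the coordinates from d on equal to zero, so g sends y
   into S, where f' makes the coordinates from d' on vanish. *)
set y := y0 + t *: _ in fUt U'gt *.
have : (f @` (U `&` S)) y.
  rewrite fS; split=> // k dk; rewrite !mxE.
  have : (f @` (U `&` S)) y0 by exists p.
  rewrite fS => -[_ /= ->] //.
  rewrite [k == i](_ : _ = false) ?mulr0 ?addr0 //.
  by apply: contraTF dk => /eqP ->; rewrite -ltnNge.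
move=> [x [Ux Sx] xy].
have gy : g y = x by rewrite -xy; have [] := fU _ Ux.
have : (f' @` (U' `&` S)) (phi y).
  by rewrite /phi /= gy; exists x => //; split; rewrite // -gy.
by rewrite fS' => -[_ /(_ j jd')].
Unshelve. all: by end_near. Qed.
End DimensionOfCharts.

(** * Coordinates on symmetric matrices of size 3 *)

Lemma ord3P (P : 'I_3 -> Prop) : P 0 -> P 1 -> P 2%:R -> forall i, P i.
Proof.
move=> P0 P1 P2 [[|[|[|//]]] i3].
- by rewrite [Ordinal _](_ : _ = 0) //; exact/val_inj.
- by rewrite [Ordinal _](_ : _ = 1) //; exact/val_inj.
- by rewrite [Ordinal _](_ : _ = 2%:R) //; exact/val_inj.
Qed.

Lemma ord6P (P : 'I_6 -> Prop) :
  P 0 -> P 1 -> P 2%:R -> P 3%:R -> P 4%:R -> P 5%:R -> forall i, P i.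
Proof.
move=> P0 P1 P2 P3 P4 P5 [[|[|[|[|[|[|//]]]]]] i6].
- by rewrite [Ordinal _](_ : _ = 0) //; exact/val_inj.
- by rewrite [Ordinal _](_ : _ = 1) //; exact/val_inj.
- by rewrite [Ordinal _](_ : _ = 2%:R) //; exact/val_inj.
- by rewrite [Ordinal _](_ : _ = 3%:R) //; exact/val_inj.
- by rewrite [Ordinal _](_ : _ = 4%:R) //; exact/val_inj.
- by rewrite [Ordinal _](_ : _ = 5%:R) //; exact/val_inj.
Qed.

Lemma rank_sym_le1 (K : numClosedFieldType) n (A : 'M[K]_n) :
  A^T = A -> (\rank A <= 1)%N -> exists u : 'rV[K]_n, A = u^T *m u.
Proof.
move=> /sym_congr_pid[P uP PA] rA1.
(* The first column of P^-1 as a row if A has rank 1, and zero if A = 0. *)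
exists (pid_mx (\rank A) *m (invmx P)^T).
rewrite trmx_mul trmxK tr_pid_mx mulmxA -(mulmxA (invmx P)) pid_mx_id // -PA.
by rewrite trmx_inv -!mulmxA mulmxV ?unitmx_tr // mulmx1 mulKmx.
Qed.

Lemma rank_outer_le1 (F : fieldType) n (u : 'rV[F]_n) : (\rank (u^T *m u) <= 1)%N.
Proof. by rewrite (leq_trans (mxrankM_maxr _ _)) // rank_leq_row. Qed.

Section SymmetricCoordinates.
Context {K : nzRingType}.

(* Row-major order of the upper triangle, A_00, A_01, A_02, A_11, A_12, A_22: the
   coordinates normal to the strata of rank 1 and 2 at their normal forms come
   last, as submanifold_of_dim requires. *)
Definition sym_of_row (x : 'rV[K]_6) : 'M[K]_3 :=
  \matrix_(i, j) x 0 (inord (i + j + (0 < minn i j))).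

Definition row_of_sym (A : 'M[K]_3) : 'rV[K]_6 :=
  \row_k [:: A 0 0; A 0 1; A 0 2%:R; A 1 1; A 1 2%:R; A 2%:R 2%:R]`_k.

Lemma sym_of_rowE (x : 'rV[K]_6) :
  let A := sym_of_row x in
  [/\ A 0 0 = x 0 0, A 0 1 = x 0 1 & A 0 2%:R = x 0 2%:R] /\
  [/\ A 1 0 = x 0 1, A 1 1 = x 0 3%:R & A 1 2%:R = x 0 4%:R] /\
  [/\ A 2%:R 0 = x 0 2%:R, A 2%:R 1 = x 0 4%:R & A 2%:R 2%:R = x 0 5%:R].
Proof.
by do ![split]; rewrite mxE; congr (x 0 _); apply: val_inj; rewrite /= inordK.
Qed.

Lemma sym_of_row_sym x : (sym_of_row x)^T = sym_of_row x.
Proof. by apply/matrixP => i j; rewrite !mxE (addnC (j : nat) i) minnC. Qed.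

Lemma sym_of_row_linear : linear sym_of_row.
Proof. by move=> k x y; apply/matrixP => i j; rewrite !mxE. Qed.

Lemma sym_of_rowK : cancel sym_of_row row_of_sym.
Proof.
move=> x; apply/rowP; have [[? ? ?] [[? ? ?] [? ? ?]]] := sym_of_rowE x.
by elim/ord6P; rewrite mxE.
Qed.

Lemma row_of_symK A : A^T = A -> sym_of_row (row_of_sym A) = A.
Proof.
move=> sA; have tA i j : A i j = A j i by rewrite -{1}sA mxE.
have [[a b c] [[d f g] [h k l]]] := sym_of_rowE (row_of_sym A).
apply/matrixP; elim/ord3P; elim/ord3P;
  by rewrite ?(a, b, c, d, f, g, h, k, l) mxE /=.
Qed.

End SymmetricCoordinates.

Lemma det_sym_of_row (K : comNzRingType) (x : 'rV[K]_6) :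
  \det (sym_of_row x) =
    x 0 0 * (x 0 3%:R * x 0 5%:R - x 0 4%:R * x 0 4%:R)
    - x 0 1 * (x 0 1 * x 0 5%:R - x 0 4%:R * x 0 2%:R)
    + x 0 2%:R * (x 0 1 * x 0 4%:R - x 0 3%:R * x 0 2%:R).
Proof.
have [[a b c] [[d f g] [h k l]]] := sym_of_rowE x.
by rewrite det_mx33 ?(a, b, c, d, f, g, h, k, l).
Qed.

(** * Charts of the rank strata *)

Section ScalarDifferentiability.
Context {K : numFieldType} {V : normedModType K}.
Implicit Types (f g : V -> K) (x : V).

Lemma differentiable_addf f g x : differentiable f x -> differentiable g x ->
  differentiable (fun y => f y + g y) x.
Proof. exact: differentiableD. Qed.

Lemma differentiable_subf f g x : differentiable f x -> differentiable g x ->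
  differentiable (fun y => f y - g y) x.
Proof. exact: differentiableB. Qed.

Lemma differentiable_mulf f g x : differentiable f x -> differentiable g x ->
  differentiable (fun y => f y * g y) x.
Proof. exact: differentiableM. Qed.

Lemma differentiable_divf f g x : differentiable f x -> differentiable g x ->
  g x != 0 -> differentiable (fun y => f y / g y) x.
Proof.
move=> df dg gx; apply: differentiable_mulf => //; exact: differentiableV.
Qed.

Lemma differentiable_rowmx n (f : 'I_n -> V -> K) x :
  (forall i, differentiable (f i) x) -> differentiable (fun y => \row_i f i y) x.
Proof.
move=> df; apply: differentiable_row => i.
by have -> : (fun y => (\row_i f i y) 0 i) = f i by apply/funext => y; rewrite mxE.
Qed.

End ScalarDifferentiability.

Ltac diff_rational := repeat first
  [ exact: differentiable_coord | exact: differentiable_cst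
  | apply: differentiable_subf | apply: differentiable_addf
  | apply: differentiable_mulf ].

Section RankStrata.
Variable K : numClosedFieldType.
Local Notation X := 'rV[K]_6.

Definition rank_stratum r : set X := [set x | \rank (sym_of_row x) = r].

Lemma det_sym_of_row_continuous : continuous (fun x : X => \det (sym_of_row x)).
Proof.
rewrite (funext (@det_sym_of_row K)) => x.
by apply: differentiable_continuous; diff_rational.
Qed.

Lemma rank3P (x : X) : rank_stratum 3 x <-> \det (sym_of_row x) != 0.
Proof.
have := @row_free_unit K 3 (sym_of_row x); rewrite unitmxE unitfE /row_free => <-.
by split=> /eqP.
Qed.

Lemma rank_lt3 (x : X) : \det (sym_of_row x) = 0 -> (\rank (sym_of_row x) < 3)%N.
Proof.
move=> d0; rewrite ltn_neqAle rank_leq_row andbT.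
by apply/eqP => /rank3P; rewrite d0 eqxx.
Qed.

(** Such a matrix is u^T u, so its 2 x 2 minors through the corner vanish. *)
Lemma rank_le1_minors (x : X) : (\rank (sym_of_row x) <= 1)%N ->
  [/\ x 0 0 * x 0 3%:R = x 0 1 ^+ 2, x 0 0 * x 0 4%:R = x 0 1 * x 0 2%:R &
      x 0 0 * x 0 5%:R = x 0 2%:R ^+ 2].
Proof.
move=> /(rank_sym_le1 (sym_of_row_sym x))[u xu].
have uE i j : sym_of_row x i j = u 0 i * u 0 j.
  by rewrite xu mxE big_ord1 mxE.
have [[<- <- <-] [[_ <- <-] [_ _ <-]]] := sym_of_rowE x.
by rewrite !uE; split; ring.
Qed.

(** The stratum is open, so the identity is a chart and no coordinate has to vanish. *)
Lemma chart_rank3 (p : X) : rank_stratum 3 p -> chart_at 6 (rank_stratum 3) p.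
Proof.
move=> /rank3P p0.
apply: (@chart_at_shear _ _ _ _ _ (fun x : X => \det (sym_of_row x)) (fun=> 0)) => //.
- exact: det_sym_of_row_continuous.
- by move=> x; rewrite subr0 addr0.
- by move=> x x0; split=> [_ i|_]; [rewrite leqNgt ltn_ord|apply/rank3P].
Qed.

Lemma chart_rank0 (p : X) : chart_at 0 (rank_stratum 0) p.
Proof.
apply: (@chart_at_shear _ _ _ _ _ (fun=> 1) (fun=> 0)) => //.
- exact: cst_continuous.
- exact: oner_neq0.
- move=> x _; rewrite /rank_stratum subr0; split=> [/eqP|x0].
    rewrite mxrank_eq0 => /eqP Ax0 i _.
    rewrite -[x]sym_of_rowK Ax0; move: i; elim/ord6P; by rewrite !mxE.
  have -> : x = 0 by apply/rowP => i; rewrite x0 ?mxE.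
  apply/eqP; rewrite mxrank_eq0; apply/eqP/matrixP => i j; by rewrite !mxE.
Qed.

(** [H] holds the entries of b^T a^-1 b for a = x_0 and b = (x_1, x_2); it involves only the first
    three coordinates, which the shear fixes. *)
Lemma chart_rank1 (p : X) : p 0 0 != 0 -> chart_at 3 (rank_stratum 1) p.
Proof.
move=> p0; pose H (x : X) : X := \row_k [:: 0; 0; 0;
  x 0 1 * x 0 1 / x 0 0; x 0 1 * x 0 2%:R / x 0 0; x 0 2%:R * x 0 2%:R / x 0 0]`_k.
apply: (@chart_at_shear _ _ _ _ _ (fun x : X => x 0 0) H) => //.
- exact: coord_continuous.
- move=> x x0; apply: differentiable_rowmx.
  elim/ord6P => /=;
    by [exact: differentiable_cst | apply: differentiable_divf => //; diff_rational].
- have H0 x : [/\ H x 0 0 = 0, H x 0 1 = 0 & H x 0 2%:R = 0] by rewrite !mxE.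
  move=> x; have [h0 h1 h2] := H0 x.
  have HP (y : X) : y 0 0 = x 0 0 -> y 0 1 = x 0 1 ->
      y 0 2%:R = x 0 2%:R -> H y = H x.
    by move=> e0 e1 e2; rewrite /H e0 e1 e2.
  split; [|apply: HP| |apply: HP];
    by rewrite !mxE ?(mxE, h0, h1, h2) /= ?subr0 ?addr0.
(* [u] is the first row of A; a zero Schur complement means A = a^-1 u^T u. *)
move=> x x0; pose u : 'rV[K]_3 := \row_i sym_of_row x 0 i.
split=> [rx|xH].
  have [e3 e4 e5] := rank_le1_minors (eq_leq rx).
  elim/ord6P => // _; rewrite !mxE /=; apply/eqP;
    rewrite subr_eq0 -(inj_eq (mulfI x0));
    by apply/eqP; rewrite ?e3 ?e4 ?e5; field.
have e3 : x 0 3%:R = x 0 1 * x 0 1 / x 0 0.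
  by apply/eqP; rewrite -subr_eq0; have := xH 3%:R isT; rewrite !mxE /= => ->.
have e4 : x 0 4%:R = x 0 1 * x 0 2%:R / x 0 0.
  by apply/eqP; rewrite -subr_eq0; have := xH 4%:R isT; rewrite !mxE /= => ->.
have e5 : x 0 5%:R = x 0 2%:R * x 0 2%:R / x 0 0.
  by apply/eqP; rewrite -subr_eq0; have := xH 5%:R isT; rewrite !mxE /= => ->.
have [[a b c] [[d f g] [h k l]]] := sym_of_rowE x.
have Au : sym_of_row x = (x 0 0)^-1 *: (u^T *m u).
  apply/matrixP; elim/ord3P; elim/ord3P;
    rewrite [RHS]mxE [X in _ = _ * X]mxE big_ord1 ![u^T _ _]mxE ![u _ _]mxE;
    rewrite ?(a, b, c, d, f, g, h, k, l) ?e3 ?e4 ?e5; by field.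
apply/eqP; rewrite eqn_leq lt0n mxrank_eq0; apply/andP; split.
  by rewrite Au mxrank_scale_nz ?invr_eq0 // rank_outer_le1.
by apply: contraNneq x0 => A0; rewrite -a A0 mxE.
Qed.

(** Here a is the leading 2 x 2 block, with determinant q, and b is the column (x_2, x_4). Then h =
    b^T adj(a) b, so h / q = b^T a^-1 b. *)
Lemma chart_rank2 (p : X) : p 0 0 * p 0 3%:R - p 0 1 * p 0 1 != 0 ->
  chart_at 5 (rank_stratum 2) p.
Proof.
pose q (x : X) := x 0 0 * x 0 3%:R - x 0 1 * x 0 1.
rewrite -/(q p) => qp.
pose h (x : X) := x 0 2%:R * x 0 2%:R * x 0 3%:R + x 0 0 * x 0 4%:R * x 0 4%:R
  - 2%:R * x 0 1 * x 0 2%:R * x 0 4%:R.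
pose H (x : X) : X := \row_k [:: 0; 0; 0; 0; 0; h x / q x]`_k.
have dq x : differentiable q x by rewrite /q; diff_rational.
apply: (@chart_at_shear _ _ _ _ _ q H) => //.
- by move=> x; apply: differentiable_continuous.
- move=> x x0; apply: differentiable_rowmx.
  elim/ord6P => /=;
    by [exact: differentiable_cst
       | apply: differentiable_divf => //; rewrite /h; diff_rational].
- have H0 x : [/\ H x 0 0 = 0, H x 0 1 = 0, H x 0 2%:R = 0,
      H x 0 3%:R = 0 & H x 0 4%:R = 0].
    by rewrite !mxE.
  move=> x; have [h0 h1 h2 h3 h4] := H0 x.
  have qP (y : X) : y 0 0 = x 0 0 -> y 0 1 = x 0 1 -> y 0 3%:R = x 0 3%:R -> q y = q x.
    by move=> e0 e1 e3; rewrite /q e0 e1 e3.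
  have HP (y : X) : y 0 0 = x 0 0 -> y 0 1 = x 0 1 -> y 0 2%:R = x 0 2%:R ->
      y 0 3%:R = x 0 3%:R -> y 0 4%:R = x 0 4%:R -> H y = H x.
    by move=> e0 e1 e2 e3 e4; rewrite /H /h /q e0 e1 e2 e3 e4.
  split; [apply: qP|apply: HP|apply: qP|apply: HP];
    by rewrite !mxE ?(mxE, h0, h1, h2) /= ?subr0 ?addr0.
(* The determinant of A is det(a) times the Schur complement, so flattening amounts to det A = 0. *)
move=> x qx; have detE : \det (sym_of_row x) = q x * (x - H x) 0 5%:R.
  have -> : (x - H x) 0 5%:R = x 0 5%:R - h x / q x by rewrite !mxE.
  have hq : q x * (h x / q x) = h x by rewrite mulrC divfK.
  by rewrite mulrBr hq det_sym_of_row /q /h; ring.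
split=> [rx|xH].
  elim/ord6P => // _; apply/eqP; rewrite -(mulrI_eq0 _ (mulfI qx)) -detE.
  by apply/negPn/negP => /rank3P; rewrite /rank_stratum /= rx.
have d0 : \det (sym_of_row x) = 0 by rewrite detE xH ?mulr0.
(* A zero determinant bounds the rank by 2, and rank at most 1 would make the minor q vanish. *)
apply/eqP; rewrite eqn_leq -ltnS rank_lt3 //= ltnNge.
apply: contraNN qx => /rank_le1_minors[e _ _].
by rewrite /q e expr2 subrr.
Qed.
End RankStrata.

(** * Strata of the representation *)

Lemma linear_inj_mulmx (F : fieldType) n (f : 'rV[F]_n -> 'rV[F]_n) :
  linear f -> injective f -> exists2 P, P \in unitmx & forall x, f x = x *m P.
Proof.
move=> flin finj; pose fL := GRing.isLinear.Build F 'rV[F]_n 'rV[F]_n *:%R f flin.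
pose ff : {linear 'rV[F]_n -> 'rV[F]_n} := HB.pack f fL.
have fE x : f x = x *m lin1_mx ff by rewrite mul_rV_lin1.
exists (lin1_mx ff) => //; rewrite -row_free_unit.
apply/inj_row_free => v; rewrite -fE => v0; apply: finj.
by rewrite v0 fE mul0mx.
Qed.

Lemma coords_linear (K : numFieldType) (E : vectType K) : linear (@coords K E).
Proof. exact: passmx.rVof_linear. Qed.

Lemma coords_inj (K : numFieldType) (E : vectType K) : injective (@coords K E).
Proof. exact: can_inj (passmx.rVofK (vbasisP _)). Qed.

Section Strata.
Variables (K : numClosedFieldType) (V : vectType K) (e : 3.-tuple V).
Hypothesis e_basis : basis_of {:V} e.
Local Notation W := (LStype V).
Implicit Types M N : W.

Let stratum (r : nat) : set W := [set M | LS_rank e M = r].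

Lemma LS_act_linear (g : 'End(V)) : bijective g -> linear (@LS_act K V g : W -> W).
Proof.
move=> gB k M N; apply: (LS_mx_inj e_basis).
rewrite LS_mxD !LS_mx_act // LS_mxD mulmxDr mulmxDl scalerDr.
by rewrite -scalemxAr -scalemxAl scalerA mulrC -scalerA.
Qed.

Lemma LS_act_inj (g : 'End(V)) : bijective g -> injective (@LS_act K V g : W -> W).
Proof.
move=> gB M N MN; have [_ ug] := end_mx_inv e_basis gB.
have dg : (\det (end_mx e g))^-1 != 0 by rewrite invr_eq0 -unitfE -unitmxE.
have /(congr1 (LS_mx e)) := MN; rewrite !LS_mx_act // => /(scalerI dg).
rewrite -!mulmxA => /(can_inj (mulKmx ug)).
have ugT : (end_mx e g)^T \in unitmx by rewrite unitmx_tr.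
by move=> /(can_inj (mulmxK ugT)) /(LS_mx_inj e_basis).
Qed.

Lemma LS_of_mxD k A B : A^T = A -> B^T = B ->
  LS_of_mx e (k *: A + B) = k *: LS_of_mx e A + LS_of_mx e B.
Proof.
move=> sA sB; apply: (LS_mx_inj e_basis).
by rewrite LS_mxD !LS_of_mxK // linearP /= sA sB.
Qed.

Definition LS_of_row (x : 'rV[K]_6) : W := LS_of_mx e (sym_of_row x).

Lemma LS_of_row_linear : linear LS_of_row.
Proof.
by move=> k x y; rewrite /LS_of_row sym_of_row_linear LS_of_mxD ?sym_of_row_sym.
Qed.

Lemma LS_of_rowK : cancel LS_of_row (row_of_sym \o LS_mx e).
Proof. by move=> x; rewrite /= LS_of_mxK ?sym_of_row_sym // sym_of_rowK. Qed.

Lemma LS_mxKrow : cancel (row_of_sym \o LS_mx e) LS_of_row.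
Proof.
move=> M; apply: (LS_mx_inj e_basis).
by rewrite /LS_of_row /= row_of_symK ?LS_mx_sym // LS_of_mxK ?LS_mx_sym.
Qed.

Lemma LS_rank_of_row x : LS_rank e (LS_of_row x) = \rank (sym_of_row x).
Proof. exact/LS_rank_of_mx/sym_of_row_sym. Qed.

Lemma dim_LStype : \dim {:W} = 6%N.
Proof.
pose fL := GRing.isLinear.Build K 'rV[K]_6 W *:%R LS_of_row LS_of_row_linear.
pose f : {linear 'rV[K]_6 -> W} := HB.pack LS_of_row fL.
have fE x : linfun f x = LS_of_row x by rewrite lfunE.
have kf : lker (linfun f) == 0%VS.
  by apply/lker0P => x y; rewrite !fE => /(can_inj LS_of_rowK).
have <- : limg (linfun f) = {:W}%VS.
  apply/eqP; rewrite eqEsubv subvf; apply/subvP => M _.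
  by rewrite -[M]LS_mxKrow -fE memv_img // memvf.
by rewrite limg_dim_eq ?(eqP kf) ?capv0 // dimvf /dim /= mul1n.
Qed.

(** The group action followed by [c], which stands for [coords], is a linear isomorphism matching
    the rank strata. The dimension is a variable [n] because that of W is 6 only by a proved
    equation. *)
Lemma chart_stratum n (c : W -> 'rV[K]_n) (g : 'End(V)) d r (p : 'rV[K]_6) :
  n = 6%N -> linear c -> injective c -> bijective g ->
  chart_at d (@rank_stratum K r) p ->
  chart_at d (c @` stratum r) (c (LS_act g (LS_of_row p))).
Proof.
move=> n6; subst n => clin cinj gB chp.
pose f x := c (LS_act g (LS_of_row x)).
have flin : linear f by move=> k x y; rewrite /f LS_of_row_linear LS_act_linear // clin.
have finj : injective f.
  by move=> x y /cinj /(LS_act_inj gB) /(can_inj LS_of_rowK).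
have [P uP fP] := linear_inj_mulmx flin finj.
rewrite -/(f p) fP; apply: chart_at_mulmx chp => // x; rewrite -fP.
rewrite /rank_stratum /= -LS_rank_of_row -(LS_rank_act e_basis _ gB); split=> [rx|].
  by exists (LS_act g (LS_of_row x)).
by move=> [M rM /cinj <-].
Qed.

Lemma stratum3_open n (c : W -> 'rV[K]_n) : n = 6%N -> linear c -> injective c ->
  exists2 O : set 'rV[K]_n, open O & forall M, O (c M) <-> stratum 3 M.
Proof.
move=> n6; subst n => clin cinj.
have flin : linear (c \o LS_of_row) by move=> k x y; rewrite /= LS_of_row_linear clin.
have finj : injective (c \o LS_of_row) by move=> x y /cinj /(can_inj LS_of_rowK).
have [P uP fP] := linear_inj_mulmx flin finj.
pose q (y : 'rV[K]_6) : K := \det (sym_of_row (y *m invmx P)).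
have cq : continuous q.
  move=> y; have qy := continuous_comp (@mulmx_continuous K 6 (invmx P) y)
    (@det_sym_of_row_continuous K (y *m invmx P)).
  exact: qy.
exists (q @^-1` [set z : K | z != 0]).
  by apply: open_comp => [y _|]; [exact: cq|exact: open_neq0].
move=> M; rewrite -[M]LS_mxKrow; set x := (_ \o _) M.
by rewrite -[c _]/((c \o LS_of_row) x) fP /q /= mulmxK // /stratum /= LS_rank_of_row -rank3P.
Qed.

Definition normal_row r : 'rV[K]_6 := row_of_sym (pid_mx r).

Lemma sym_of_normal_row r : sym_of_row (normal_row r) = pid_mx r.
Proof. by rewrite row_of_symK // tr_pid_mx. Qed.

Lemma stratum_normal_row r M : (r <= 3)%N -> stratum r M ->
  exists2 g : 'End(V), bijective g & M = LS_act g (LS_of_row (normal_row r)).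
Proof.
move=> r3 rM; suff /(LS_orbitP e_basis)[g [gB ->]] :
  LS_rank e M = LS_rank e (LS_of_row (normal_row r)).
  by exists g.
by rewrite LS_rank_of_row sym_of_normal_row rank_pid_mx.
Qed.

(** For r at most 3 these are the values r(7 - r)/2. *)
Definition stratum_dim (r : nat) : nat := nth 0%N [:: 0; 3; 5; 6]%N r.

Lemma chart_normal_row r : (r <= 3)%N ->
  chart_at (stratum_dim r) (@rank_stratum K r) (normal_row r).
Proof.
case: r => [|[|[|[|//]]]] _.
- exact: chart_rank0.
- by apply: chart_rank1; rewrite !mxE /= oner_neq0.
- by apply: chart_rank2; rewrite !mxE /= mulr0 subr0 mulr1 oner_neq0.
- by apply: chart_rank3; rewrite /rank_stratum /= sym_of_normal_row rank_pid_mx.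
Qed.

(** Homogeneity: a group element carries the chart at the normal form to any other point of the
    stratum. *)
Lemma stratum_submanifold r : (r <= 3)%N ->
  submanifold_of_dim (stratum_dim r) (stratum r).
Proof.
move=> r3; apply/submanifold_of_dimE; split.
  by rewrite dim_LStype; case: r r3 => [|[|[|[|]]]].
move=> M /(stratum_normal_row r3)[g gB ->].
apply: chart_stratum => //; first exact: dim_LStype.
- exact: coords_linear.
- exact: coords_inj.
- exact: chart_normal_row.
Qed.

(** The point [M] excludes the empty set, which is a submanifold of every dimension up to that of W.
    At [M] the two charts are compared in both orders. *)
Lemma submanifold_dim_unique d d' (S : set W) M : S M ->
  submanifold_of_dim d S -> submanifold_of_dim d' S -> d = d'.
Proof.
move=> SM /submanifold_of_dimE[dn Sd] /submanifold_of_dimE[dn' Sd'].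
have cM : (@coords K W @` S) (coords M) by exists M.
apply/eqP; rewrite eqn_leq.
rewrite (chart_at_dim_le dn cM (Sd _ SM) (Sd' _ SM)).
exact: chart_at_dim_le dn' cM (Sd' _ SM) (Sd _ SM).
Qed.

(** The matrix is diag(1_r, t, .., t, 0, .., 0) with s - r entries t, that is, [pid_mx s] times an
    invertible diagonal matrix. *)
Lemma rank_pid_segment r s (t : K) : (r <= s)%N -> (s <= 3)%N -> t != 0 ->
  \rank (t *: (pid_mx s - pid_mx r) + pid_mx r : 'M[K]_3)%R = s.
Proof.
move=> rs s3 t0; have r3 := leq_trans rs s3.
pose Ir : 'M[K]_3 := pid_mx r; pose Is : 'M[K]_3 := pid_mx s.
have rr : Ir *m Ir = Ir by rewrite pid_mx_id.
have sr : Is *m Ir = Ir by rewrite mul_pid_mx (minn_idPr rs) (minn_idPr r3).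
(* diag(1_r, u, .., u), with inverse T u^-1 *)
pose T u : 'M[K]_3 := u *: 1%:M + (1 - u) *: Ir.
have uT : T t \in unitmx.
  suff TT : T t *m T t^-1 = 1%:M by exact: (mulmx1_unit TT).1.
  rewrite /T mulmxDl !mulmxDr -!scalemxAl -!scalemxAr !mul1mx mulmx1 rr !scalerA.
  rewrite mulfV // scale1r -!addrA -!scalerDl.
  by rewrite [X in X *: Ir](_ : _ = 0) ?scale0r ?addr0 //; field.
have -> : t *: (Is - Ir) + Ir = Is *m T t.
  rewrite /T mulmxDr -!scalemxAr mulmx1 sr scalerBr scalerBl scale1r.
  by rewrite -!addrA (addrC Ir).
by rewrite mxrankMfree ?row_free_unit // rank_pid_mx.
Qed.

(** A segment leaves the normal form of rank r into the stratum of rank s; the linear action of g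
    carries it to a segment starting at N. *)
Lemma stratum_closure r s N : (r <= s)%N -> (s <= 3)%N -> stratum r N ->
  closure (stratum s : set (usual W)) (N : usual W).
Proof.
move=> rs s3 rN; have r3 := leq_trans rs s3.
have [g gB NE] := stratum_normal_row r3 rN.
pose Dr : 'rV[K]_6 := normal_row s - normal_row r.
pose D := LS_act g (LS_of_row Dr).
have NtE t : t *: D + N = LS_act g (LS_of_row (t *: Dr + normal_row r)).
  by rewrite LS_of_row_linear LS_act_linear // -NE.
have sNt t : t != 0 -> stratum s (t *: D + N).
  move=> t0; rewrite /stratum /= NtE (LS_rank_act e_basis) // LS_rank_of_row.
  have sB x y : sym_of_row (x - y) = sym_of_row x - sym_of_row y :> 'M[K]_3.
    by apply/matrixP => i j; rewrite !mxE.
  by rewrite sym_of_row_linear sB !sym_of_normal_row rank_pid_segment.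
move=> B [_ [[O oO <-] ON OB]].
have cont : (t *: coords D + coords N) @[t --> (0 : K)] --> coords N.
  rewrite -[X in _ --> X]add0r -(scale0r (coords D)).
  exact: (cvgD (@scalel_continuous _ _ (coords D) 0) (cvg_cst (coords N))).
(* Rank s is guaranteed for t != 0, so t is taken from a punctured neighbourhood of 0. *)
have nO : \forall t \near (0 : K)^', t != 0 /\ O (t *: coords D + coords N).
  apply: filterI; first by have := @nbhs_dnbhs_neq K 0.
  by apply: nbhs_dnbhs; apply: cont; exact: open_nbhs_nbhs.
have [t [t0 Ot]] := filter_ex nO.
exists (t *: D + N); split; first exact: sNt.
by apply: OB; rewrite /= coords_linear.
Qed.

Lemma LS_orbit_stratum M : LS_orbit M = stratum (LS_rank e M).
Proof. by apply/seteqP; split=> N; case: (LS_orbitP e_basis M N). Qed.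

End Strata.

(** * Orbits, dimensions, closures and irreducibility *)

Theorem mainTheorem6 (R : realType) (V : vectType (cplx R))
    (dimV : \dim {:V} = 3%N) (e : 3.-tuple V) (e_basis : basis_of {:V} e) :
  let W := LStype V in
  let stratum (r : nat) : set W := [set M | LS_rank e M = r] in
  [/\ (* exactly four orbits, classified by the rank *)
      [/\ (range (@LS_orbit _ V) #= `I_4)%card,
          (forall M : W, LS_orbit M = stratum (LS_rank e M)) &
          range (@LS_rank _ V e) = `I_4],
      (* dimensions, and the open dense orbit *)
      [/\ submanifold_of_dim 6 (stratum 3%N),
          open (stratum 3%N : set (usual W)),
          dense (stratum 3%N : set (usual W)) &
          [/\ submanifold_of_dim 5 (stratum 2%N),
              submanifold_of_dim 3 (stratum 1%N) &
              submanifold_of_dim 0 (stratum 0%N)]],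
      (* closures *)
      (forall (M N : W) (d d' : nat),
          submanifold_of_dim d (LS_orbit M) ->
          submanifold_of_dim d' (LS_orbit N) ->
          (d' < d)%N ->
          (LS_orbit N : set (usual W)) `<=`
            closure (LS_orbit M : set (usual W))) &
      LS_irreducible V].
Proof.
move=> W stratum.
have orbE (M : W) : LS_orbit M = stratum (LS_rank e M) by exact: LS_orbit_stratum.
have rankE : range (@LS_rank _ V e) = `I_4.
  apply/seteqP; split=> [_ [M _ <-]|r r3]; first exact: LS_rank_le3.
  exists (LS_of_row e (normal_row _ r)) => //.
  by rewrite LS_rank_of_row // sym_of_normal_row rank_pid_mx.
have sub := stratum_submanifold e_basis.
split; last exact: LS_irreducible_dim3 e_basis.
- split=> //.
  have -> : range (@LS_orbit _ V) = stratum @` `I_4.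
    by rewrite -rankE image_comp; apply: eq_imagel => M _; exact: orbE.
  (* The strata of ranks 0 to 3 are nonempty, so distinct ranks give distinct strata. *)
  apply: inj_card_eq => r s /set_mem; rewrite -rankE => -[M _ rM] _ rs.
  by have : stratum r M by []; rewrite rs /stratum /= rM.
- split; [exact: (sub 3%N)| | |split; [exact: (sub 2%N)|exact: (sub 1%N)|exact: (sub 0%N)]].
    have [O oO OE] := stratum3_open e_basis (dim_LStype e_basis)
      (@coords_linear _ W) (@coords_inj _ W).
    exists O => //; apply/seteqP; split=> M; by case: (OE M).
  move=> O [N ON] oO.
  (* Density: every point has rank at most 3 and so lies in the closure of the stratum of rank 3. *)
  have := stratum_closure e_basis (LS_rank_le3 e N) (leqnn 3)
    (erefl : stratum _ N).
  move=> /(_ O); rewrite setIC; apply; exact: open_nbhs_nbhs.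
move=> M N d d' subM subN d'd N' NN'.
have rM := LS_rank_le3 e M; have rN := LS_rank_le3 e N.
rewrite orbE in subM *; rewrite orbE in subN NN' *.
(* Uniqueness identifies d and d' with the dimensions 0, 3, 5, 6 of the strata. These increase with
   the rank, so d' < d puts the rank of N below that of M. *)
have dM := submanifold_dim_unique (erefl : stratum _ M) subM (sub _ rM).
have dN := submanifold_dim_unique (erefl : stratum _ N) subN (sub _ rN).
apply: (stratum_closure e_basis _ rM NN').
move: d'd; rewrite dM dN; move: rM rN.
case: (LS_rank e M) => [|[|[|[|//]]]] _; by case: (LS_rank e N) => [|[|[|[|//]]]].
Qed.
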